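(* Let $n\ge 2$ be an integer, $\lambda\in\mathbb{C}$, $\alpha=-\lambda-\frac{n-1}{2}$, and let $F_l=F_l(\xi_1,\dots,\xi_n)$, $l\in\mathbb{N}_0$, be the normalized $\mathfrak{so}(n,1,\mathbb{R})$-singular vectors in the scalar generalized Verma module $M^{\mathfrak g}_{\mathfrak p}(\lambda)\simeq\mathbb{C}[\xi_1,\dots,\xi_n]$ of $\mathfrak g=\mathfrak{so}(n+1,1,\mathbb{R})$ (described in the context). Let $l\in\mathbb{N}_0$. Then the collection of operators $\{e_\xi(l),f_\xi(l),h_\xi(l)\}_{l\in\mathbb{N}_0}$ in the variables $\xi_1,\dots,\xi_n$, $$e_\xi(l):=-\Big(\sum_{i=1}^n\xi_i^2\Big)\partial_{\xi_n}-(l+2\alpha)\xi_n:\ \langle F_l\rangle\to\langle F_{l+1}\rangle,$$ $$f_\xi(l):=\frac{1}{\xi_n}\left(\frac{\sum_{i=1}^n\xi_i^2}{\sum_{i=1}^{n-1}\xi_i^2}\,(\xi_n\partial_{\xi_n}-l)+l\right):\ \langle F_l\rangle\to\langle F_{l-1}\rangle,$$ $$h_\xi(l):=2(l+\alpha)\,\mathrm{Id}:\ \langle F_l\rangle\to\langle F_l\rangle,$$ fulfill the $\mathfrak{sl}(2,\mathbb{C})$-commutation relations, and $F_l(\xi_1,\dots,\xi_n)$, $l\in\mathbb{N}_0$, are the one-dimensional weight spaces of a highest weight $\mathfrak{sl}(2,\mathbb{C})$-Verma module.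
   Context: $\mathbb{N}_0=\{0,1,2,\dots\}$; $\langle\cdot\rangle$ is the complex linear span; $F_{-1}=0$; $(a)_k=a(a+1)\cdots(a+k-1)$, $(a)_0=1$. Setting: $\mathfrak g=\mathfrak{so}(n+1,1,\mathbb{R})$ with parabolic subalgebra $\mathfrak p=(\mathfrak{so}(n,\mathbb{R})\times\mathbb{R})\ltimes\mathbb{R}^n$, and $\mathfrak g'=\mathfrak{so}(n,1,\mathbb{R})\subset\mathfrak g$ with $\mathfrak p'=(\mathfrak{so}(n-1,\mathbb{R})\times\mathbb{R})\ltimes\mathbb{R}^{n-1}\subset\mathfrak p$. The scalar generalized Verma module $M^{\mathfrak g}_{\mathfrak p}(\lambda)$, induced from a complex character of $\mathfrak p$ with parameter $\lambda$, is identified as a vector space with $\mathbb{C}[\xi_1,\dots,\xi_n]$, where $\xi_1,\dots,\xi_{n-1}$ correspond to the opposite nilradical of $\mathfrak p'$. Its $\mathfrak g'$-singular vectors are given by the homogeneous polynomials $\xi_n^l\,\tilde C_l^{\alpha}(-t^{-1})$, $l\in\mathbb{N}_0$, where $t=\xi_n^{-2}\sum_{i=1}^{n-1}\xi_i^2$ and $\tilde C^\alpha_l$ is defined from the Gegenbauer polynomial $C^\alpha_l$ by $x^{-l}C_l^\alpha(x)=\tilde C_l^\alpha(x^2)$, with $x^2=-t^{-1}$. Here $C_l^\alpha(x)=\sum_{k=0}^{\lfloor l/2\rfloor}(-1)^k\frac{(\alpha)_{l-k}}{k!\,(l-2k)!}(2x)^{l-2k}$. The normalized singular vector $F_l$ is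 the multiple of $\xi_n^l\tilde C^\alpha_l(-t^{-1})$ (continued polynomially in $\alpha$) whose coefficient at the highest power of $\sum_{i=1}^{n-1}\xi_i^2$ is independent of $\lambda$. Explicitly, $$F_l=\sum_{k=0}^{\lfloor l/2\rfloor}\frac{l!\,2^{\lfloor l/2\rfloor-2k}}{k!\,(l-2k)!}\,\big(\alpha+\lceil l/2\rceil\big)_{\lfloor l/2\rfloor-k}\Big(\sum_{i=1}^{n-1}\xi_i^2\Big)^k\xi_n^{\,l-2k}.$$ For example, $F_0=1$, $F_1=\xi_n$, $F_2=-(2\lambda+n-3)\xi_n^2+\sum_{i=1}^{n-1}\xi_i^2$, $F_3=-(2\lambda+n-5)\xi_n^3+3\xi_n\sum_{i=1}^{n-1}\xi_i^2$. The operators act on rational functions in $\xi_1,\dots,\xi_n$. With $e,f,h$ acting on $\langle F_l\rangle$ by $e_\xi(l),f_\xi(l),h_\xi(l)$, the commutation relations are $[e,f]=h$, $[h,e]=2e$, $[h,f]=-2f$, with commutators understood degreewise, e.g. $[e,f]F_l=(e_\xi(l-1)f_\xi(l)-f_\xi(l+1)e_\xi(l))F_l$. The vector $F_0$ is annihilated by $f$, so ''highest weight'' refers to the convention in which $f$ plays the role of the raising operator, i.e. to the triple $(f,e,-h)$.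
   Formalization: The Verma module claim is false when α is in {0,-1,-2,...} (e.g. α=0 gives e_ξ(0)F_0=0), so it is stated as holding exactly when α is not in that set; the mapping properties, commutation relations and one-dimensional weight spaces are proved for every λ. *)

(* Defs.v *)
From HB Require Import structures.
From mathcomp Require Import all_boot all_order all_algebra.
From mathcomp Require Import reals complex mpoly.

Set Implicit Arguments.
Unset Strict Implicit.
Unset Printing Implicit Defensive.

Import Order.TTheory GRing.Theory Num.Theory.
Local Open Scope ring_scope.

Notation "x %:F" := (@FracField.tofrac _ x) : ring_scope.

Section RationalFunctions.
Variables (C : fieldType) (n : nat).

Definition ratfun := {fraction {mpoly C[n]}}.

Definition cst (c : C) : ratfun := (c%:MP_[n])%:F.

Definition xi (i : 'I_n) : ratfun := ('X_i : {mpoly C[n]})%:F.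

(* Quotient rule on the representative fraction chosen by [repr]; the value
   does not depend on that choice. *)
Definition pder (i : 'I_n) (x : ratfun) : ratfun :=
  let p := \n_(repr x) in
  let q := \d_(repr x) in
  (mderiv i p * q - p * mderiv i q)%:F / (q ^+ 2)%:F.

Definition line (p : {mpoly C[n]}) (x : ratfun) : Prop :=
  exists c : C, x = (c *: p)%:F.

End RationalFunctions.

Definition poch (C : fieldType) (a : C) (k : nat) : C :=
  \prod_(j < k) (a + j%:R).

(* [N] is the index of the distinguished variable xi_n; the other indices stand
   for xi_1, ..., xi_{n-1}. *)
Section SingularVectors.
Variables (C : fieldType) (n : nat) (N : 'I_n) (alpha : C).

Definition sumsq' : {mpoly C[n]} := \sum_(i < n | i != N) 'X_i ^+ 2.
Definition sumsq : {mpoly C[n]} := \sum_(i < n) 'X_i ^+ 2.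

Definition Fcoef (l k : nat) : C :=
  l`!%:R * 2 ^ ((l./2)%:Z - (k.*2)%:Z) / (k`!%:R * (l - k.*2)`!%:R)
  * poch (alpha + (uphalf l)%:R) (l./2 - k).

(* [F_{-1} = 0] is needed for the relations in degree 0, whence the index in
   [int]. *)
Definition Fvec (l : int) : {mpoly C[n]} :=
  match l with
  | Posz l => \sum_(k < (l./2).+1)
                Fcoef l k *: (sumsq' ^+ k * 'X_N ^+ (l - k.*2))
  | Negz _ => 0
  end.

Definition e_xi (l : int) (x : ratfun C n) : ratfun C n :=
  - (sumsq%:F * pder N x) - cst n (l%:~R + 2 * alpha) * xi C N * x.

Definition f_xi (l : int) (x : ratfun C n) : ratfun C n :=
  (xi C N)^-1 *
  (sumsq%:F / sumsq'%:F * (xi C N * pder N x - cst n l%:~R * x)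
   + cst n l%:~R * x).

Definition h_xi (l : int) (x : ratfun C n) : ratfun C n :=
  cst n (2 * (l%:~R + alpha)) * x.

End SingularVectors.

Section SL2.
Variable C : fieldType.

Definition sl2_module (V : lmodType C) (X Y H : {linear V -> V}) : Prop :=
  [/\ forall v, X (Y v) - Y (X v) = H v,
      forall v, H (X v) - X (H v) = 2 *: X v
    & forall v, H (Y v) - Y (H v) = - 2 *: Y v].

(* [X] raises and [Y] lowers.  The last clause is the universal property of the
   induced module U(sl_2) (x)_{U(b)} C_mu with generator [v0] = 1 (x) 1, i.e.
   Hom_{sl_2}(V, W) = Hom_b(C_mu, W) for every sl_2-module W. *)
Definition verma_module (V : lmodType C) (X Y H : {linear V -> V})
    (mu : C) (v0 : V) : Prop :=
  [/\ sl2_module X Y H,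
      X v0 = 0,
      H v0 = mu *: v0
    & forall (W : lmodType C) (X' Y' H' : {linear W -> W}) (w0 : W),
        sl2_module X' Y' H' -> X' w0 = 0 -> H' w0 = mu *: w0 ->
        let hom (phi : {linear V -> W}) :=
          [/\ forall v, phi (X v) = X' (phi v),
              forall v, phi (Y v) = Y' (phi v),
              forall v, phi (H v) = H' (phi v)
            & phi v0 = w0] in
        exists phi : {linear V -> W},
          hom phi /\ forall psi : {linear V -> W}, hom psi -> psi =1 phi].

End SL2.

(* (V, E, F, H) is the direct sum of the lines <F_l>, l >= 0, on which E, F, H
   act by [e_xi l], [f_xi l], [h_xi l]; [iota] identifies the summands with the
   lines inside C[xi_1, ..., xi_n]. *)
Definition realizes (C : fieldType) (n : nat) (N : 'I_n) (alpha : C)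
    (V : lmodType C) (E F H : {linear V -> V})
    (iota : {linear V -> {mpoly C[n]}}) : Prop :=
  [/\ injective iota,
      forall p : {mpoly C[n]}, (exists v, iota v = p) <->
        exists (m : nat) (c : nat -> C),
          p = \sum_(l < m) c l *: Fvec N alpha l%:Z
    & forall (l : nat) (v : V), line (Fvec N alpha l%:Z) (iota v)%:F ->
        [/\ (iota (E v))%:F = e_xi N alpha l%:Z (iota v)%:F,
            (iota (F v))%:F = f_xi N l%:Z (iota v)%:F
          & (iota (H v))%:F = h_xi alpha l%:Z (iota v)%:F]].

(* Main.v *)
Require Import Defs.
From HB Require Import structures.
From mathcomp Require Import all_boot all_order all_algebra.
From mathcomp Require Import reals complex mpoly.
From mathcomp Require Import zify ring.
Import Order.TTheory GRing.Theory Num.Theory.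
Local Open Scope ring_scope.

(** Comparing coefficients of [sumsq' ^ k * xi_n ^ (l + 1 - 2 k)] gives
    [e F_l = c_l F_(l+1)] and [f F_l = d_l F_(l-1)], where [c_l] is [-1] for odd
    [l] and [-(l + 2 alpha)] for even [l], and [d_l] is [l] for odd [l] and
    [l (l - 1 + 2 alpha)] for even [l]. In every degree
    [c_l d_(l+1) = -(l+1) (l + 2 alpha)], which yields the commutation relations.
    The [F_l] are nonzero and homogeneous of different degrees, so their span is
    modelled on [{poly C}], with ['X^l] in the role of [F_l]. This module is
    generated by [F_0], and is then a Verma module, exactly when no [c_l]
    vanishes, that is when [alpha] is not in [{0, -1, -2, ...}]. *)

(** * Recurrences for the coefficients of the singular vectors *)

Section Coefficients.
Variables (C : numFieldType) (alpha : C).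

Definition raise_cst (l : nat) : C := if odd l then -1 else - (l%:R + 2 * alpha).

Definition lower_cst (l : nat) : C :=
  if odd l then l%:R else l%:R * (l%:R - 1 + 2 * alpha).

(* The coefficient of [sumsq' ^ k * xi_n ^ (l - 2 k)] in [F_l]: unlike [Fcoef], it
   vanishes for [2 k > l], where the subtractions are truncated. *)
Definition fcoef (l k : nat) : C := if (k.*2 <= l)%N then Fcoef alpha l k else 0.

Lemma poch0 (a : C) : poch a 0 = 1.
Proof. by rewrite /poch big_ord0. Qed.

Lemma pochSr (a : C) k : poch a k.+1 = poch a k * (a + k%:R).
Proof. by rewrite /poch big_ord_recr. Qed.

Lemma pochSl (a : C) k : poch a k.+1 = a * poch (a + 1) k.
Proof.
rewrite /poch big_ord_recl addr0; congr (_ * _).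
by apply: eq_bigr => i _; rewrite /= /bump add1n -natr1; ring.
Qed.

(** Writing the half degree as [k + i] removes all truncated subtractions and turns the integer
    power of 2 into a quotient of natural powers, a form that [field] can handle. *)
Lemma fcoef_odd k i :
  fcoef (k + i).*2.+1 k =
  (k + i).*2.+1`!%:R * 2 ^+ i / 2 ^+ k / (k`!%:R * i.*2.+1`!%:R)
  * poch (alpha + (k + i)%:R + 1) i.
Proof.
rewrite /fcoef ifT; last by lia.
rewrite /Fcoef /= doubleK uphalf_double -addrA natr1.
have -> : ((k + i)%:Z - k.*2%:Z) = i%:Z - k%:Z by lia.
have -> : ((k + i).*2.+1 - k.*2)%N = i.*2.+1 by lia.
have -> : (k + i - k)%N = i by lia.
by rewrite expfzDr ?pnatr_eq0 // exprnN -exprnP mulrA.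
Qed.

Lemma fcoef_even k i :
  fcoef (k + i).*2 k =
  (k + i).*2`!%:R * 2 ^+ i / 2 ^+ k / (k`!%:R * i.*2`!%:R)
  * poch (alpha + (k + i)%:R) i.
Proof.
rewrite /fcoef ifT; last by lia.
rewrite /Fcoef uphalf_double doubleK.
have -> : ((k + i)%:Z - k.*2%:Z) = i%:Z - k%:Z by lia.
have -> : ((k + i).*2 - k.*2)%N = i.*2 by lia.
have -> : (k + i - k)%N = i by lia.
by rewrite expfzDr ?pnatr_eq0 // exprnN -exprnP mulrA.
Qed.

Lemma fcoef_gt l k : (l < k.*2)%N -> fcoef l k = 0.
Proof. by move=> lk; rewrite /fcoef leqNgt lk. Qed.

Lemma fact_neq0 k : k`!%:R != 0 :> C.
Proof. by rewrite pnatr_eq0 -lt0n fact_gt0. Qed.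

Lemma pow2_neq0 k : 2 ^+ k != 0 :> C.
Proof. by rewrite expf_neq0 ?pnatr_eq0. Qed.

Lemma natrS_neq0 k : k%:R + 1 != 0 :> C.
Proof. by rewrite natr1 pnatr_eq0. Qed.

Lemma double_or_doubleS (l : nat) : exists k, l = k.*2 \/ l = k.*2.+1.
Proof. by exists l./2; case: (odd l) (odd_double_half l) => /= <-; lia. Qed.

(* Rewriting with [natr1] also unfolds the literal [2], so the powers of 2 are
   generalized first. *)
Local Ltac coef_field k i :=
  rewrite ?addn0 ?double0 ?poch0 ?fact0 ?addSn ?addnS ?doubleS ?factS ?exprS
    ?expr0 -?muln2 ?natrM;
  have := fact_neq0 k; have := pow2_neq0 k;
  have := fact_neq0 (i * 2); have := pow2_neq0 i;
  have := natrS_neq0 k; have := natrS_neq0 (i * 2);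
  have := natrS_neq0 1; have := natrS_neq0 (i * 2).+1;
  have := natrS_neq0 (i * 2).+2; have := natrS_neq0 (i * 2).+3;
  move: (2 ^+ k) (k`!%:R) => ? ?;
  try (move: (2 ^+ i) ((i * 2)`!%:R) => ? ?);
  try (move: (((k + i) * 2)`!%:R) => ?);
  rewrite -?natr1 ?natrM ?natrD => *;
  field; do ?[apply/andP; split]; by rewrite // ?add0r.

(** This compares the coefficients of [sumsq' ^ k.+1 * xi_n ^ (l.+1 - 2 k)] in the equation
    [f F_(l+1) = d_(l+1) F_l] multiplied by [sumsq' * xi_n]. *)
Lemma fcoef_lower l k :
  (l.+1 - k.*2)%:R * fcoef l.+1 k - (k.+1).*2%:R * fcoef l.+1 k.+1 =
  lower_cst l.+1 * fcoef l k.
Proof.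
have [lt_lk | le_kl] := ltnP l k.*2.
  rewrite (fcoef_gt l) // (fcoef_gt l.+1 k.+1); last by lia.
  (* For [2 k = l + 1] the coefficient [fcoef l.+1 k] need not vanish, but its factor does; for
     larger [k] the factor is zero by truncation. *)
  by rewrite (_ : l.+1 - k.*2 = 0)%N; [ring | lia].
have [m [lE | lE]] := double_or_doubleS l.
  have [i mE] : exists i, m = (k + i)%N by exists (m - k)%N; lia.
  rewrite lE mE {le_kl lE mE} /lower_cst /= odd_double /= fcoef_odd fcoef_even.
  rewrite (_ : (k + i).*2.+1 - k.*2 = i.*2.+1)%N; last by lia.
  (* For [i = 0] the index [k] is the last one in degree [l.+1], so the term at [k.+1] is absent. *)
  case: i => [|i].
    rewrite fcoef_gt; last by lia.
    by coef_field k k.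
  have -> : (k + i.+1 = k.+1 + i)%N by lia.
  (* Splitting off a last factor in one Pochhammer symbol and a first factor in another leaves a
     common symbol of length [i]. *)
  rewrite fcoef_odd pochSr pochSl.
  by coef_field k i.
have [i mE] : exists i, m = (k + i)%N by exists (m - k)%N; lia.
rewrite lE mE {le_kl lE mE} fcoef_odd /lower_cst -doubleS odd_double.
have -> : ((k + i).+1 = k + i.+1)%N by lia.
rewrite fcoef_even.
have -> : (k + i.+1 = k.+1 + i)%N by lia.
rewrite fcoef_even.
rewrite (_ : (k.+1 + i).*2 - k.*2 = i.*2.+2)%N; last by lia.
rewrite pochSr addSn -[(k + i).+1%:R]natr1 addrA.
by coef_field k i.
Qed.

(** This is the coefficient of the pure power [xi_n ^ l.+1] in [e F_l = c_l F_(l+1)], to which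
    [sumsq' * pder N] does not contribute. *)
Lemma fcoef_raise0 l :
  - ((l%:R + alpha) * 2 * fcoef l 0) = raise_cst l * fcoef l.+1 0.
Proof.
rewrite /raise_cst; have [m [-> | ->]] := double_or_doubleS l.
  have := fcoef_odd 0 m; rewrite /= !add0n => ->.
  have := fcoef_even 0 m; rewrite /= !add0n => ->.
  rewrite odd_double; case: m => [|m]; first by coef_field 0%N 0%N.
  rewrite pochSl pochSr.
  by coef_field 0%N m.
have := fcoef_odd 0 m; rewrite /= !add0n => ->.
have := fcoef_even 0 m.+1; rewrite /= !add0n -doubleS => ->.
rewrite odd_double /= pochSr -[m.+1%:R]natr1 addrA.
by coef_field 0%N m.
Qed.

(** For the terms that contain [sumsq']: index [k] contributes through [sumsq' * pder N], and index
    [k.+1] through the part of [e] that leaves the power of [sumsq'] unchanged. *)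
Lemma fcoef_raise l k :
  - ((l - k.*2)%:R * fcoef l k)
  - (l%:R - k.+1%:R + alpha) * 2 * fcoef l k.+1 =
  raise_cst l * fcoef l.+1 k.+1.
Proof.
have [lt_lk | le_kl] := ltnP l k.*2.+1.
  rewrite (fcoef_gt l k.+1) ?(fcoef_gt l.+1 k.+1); [|lia|lia].
  by rewrite (_ : l - k.*2 = 0)%N; [ring | lia].
rewrite /raise_cst; have [m [lE | lE]] := double_or_doubleS l.
  have [i mE] : exists i, m = (k.+1 + i)%N by exists (m - k.+1)%N; lia.
  rewrite lE mE {le_kl lE mE} fcoef_odd fcoef_even odd_double.
  have -> : (k.+1 + i = k + i.+1)%N by lia.
  rewrite fcoef_even.
  rewrite (_ : (k + i.+1).*2 - k.*2 = i.*2.+2)%N; last by lia.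
  rewrite addnS -addSn.
  case: i => [|i].
    by rewrite pochSr (_ : 1.*2`! = 2)%N // ?addn0; coef_field k k.
  rewrite (pochSl _ i.+1) (pochSl (alpha + _%:R) i) (pochSr _ i).
  by coef_field k i.
have [i mE] : exists i, m = (k + i)%N by exists (m - k)%N; lia.
rewrite lE mE {le_kl lE mE} -doubleS /= odd_double /= fcoef_odd.
rewrite (_ : (k + i).*2.+1 - k.*2 = i.*2.+1)%N; last by lia.
rewrite -addSn fcoef_even; case: i => [|i].
  by rewrite fcoef_gt; [coef_field k k | lia].
have -> : (k + i.+1 = k.+1 + i)%N by lia.
rewrite fcoef_odd addnS pochSr -[(k.+1 + i).+1%:R]natr1 addrA pochSr.
by coef_field k i.
Qed.

End Coefficients.

(** * Derivatives of polynomials inside the field of rational functions *)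

Section PolynomialArguments.
Variables (C : fieldType) (n : nat).
Implicit Types p q : {mpoly C[n]}.

Lemma cst_mul (c : C) p : cst n c * p%:F = (c *: p)%:F.
Proof. by rewrite /cst -tofracM mul_mpolyC. Qed.

(** The representative chosen for a polynomial [p] has numerator [p] times its denominator, so the
    quotient rule collapses. *)
Lemma pder_tofrac (i : 'I_n) p : pder i p%:F = (mderiv i p)%:F.
Proof.
rewrite /pder; set x := repr _.
have x2 : \d_x != 0 by exact: denom_ratioP.
have xE : \n_x = p * \d_x.
  have := reprK (p%:F : ratfun C n); rewrite -/x; unlock FracField.tofrac.
  move=> /eqmodP /eqP /=.
  by rewrite !numden_Ratio ?oner_neq0 // mulr1 mulrC.
rewrite xE mderivM.
have -> : (mderiv i p * \d_x + p * mderiv i \d_x) * \d_x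
          - p * \d_x * mderiv i \d_x = mderiv i p * \d_x ^+ 2 by ring.
by rewrite tofracM mulfK // tofrac_eq0 expf_neq0.
Qed.

Lemma mderivXn (i : 'I_n) p k :
  mderiv i (p ^+ k) = k%:R *: (mderiv i p * p ^+ k.-1).
Proof.
elim: k => [|k IH]; first by rewrite expr0 scale0r -mpolyC1 mderivC.
rewrite exprS mderivM IH; case: k {IH} => [|k].
  by rewrite scale0r mulr0 addr0 scale1r.
rewrite -[k.+2%:R]natr1 scalerDl scale1r addrC; congr (_ + _).
by rewrite -scalerAr mulrCA -exprS.
Qed.

Lemma mderivXU (i j : 'I_n) : mderiv i ('X_j : {mpoly C[n]}) = (i == j)%:R.
Proof.
rewrite mderivX mnm1E eq_sym; case: eqP => [->|_]; last by rewrite scale0r.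
by rewrite scale1r -{1}[U_(j)%MM]add0m addmK mpolyX0.
Qed.

Lemma mpolyXU_neq0 (i : 'I_n) : ('X_i : {mpoly C[n]}) != 0.
Proof. by rewrite -msupp_eq0 msuppX. Qed.

Lemma xi_neq0 (i : 'I_n) : xi C i != 0.
Proof. by rewrite tofrac_eq0 mpolyXU_neq0. Qed.

End PolynomialArguments.

(** * The raising and lowering identities between polynomials *)

Section SingularVectors.
Variables (C : numFieldType) (n : nat) (N : 'I_n) (alpha : C).

Local Notation S := (sumsq' C N).
Local Notation x := ('X_N : {mpoly C[n]}).
Local Notation F := (Fvec N alpha).
Local Notation c := (raise_cst C alpha).
Local Notation d := (lower_cst C alpha).

Lemma other_index : (2 <= n)%N -> exists j : 'I_n, j != N.
Proof.
move=> hn; case: (posnP N) => [N0 | N_gt0].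
  by exists (Ordinal hn); rewrite -val_eqE /= N0.
have n_gt0 : (0 < n)%N by lia.
by exists (Ordinal n_gt0); rewrite -val_eqE /= eq_sym -lt0n.
Qed.

(** The [j]-th unit vector. For [j != N] it kills [xi_n] and gives [sumsq'] the value 1, so
    evaluation there isolates the pure power of [sumsq']. *)
Definition other_point (j i : 'I_n) : C := (i == j)%:R.

Lemma meval_sumsq' (j : 'I_n) : j != N -> S.@[other_point j] = 1.
Proof.
move=> jN; rewrite /sumsq' raddf_sum /= (bigD1 j) //= rmorphXn /= mevalXU.
rewrite /other_point eqxx expr1n big1 ?addr0 // => i /andP[_ ij].
by rewrite rmorphXn /= mevalXU (negPf ij) expr0n.
Qed.

Lemma sumsq'_neq0 : (2 <= n)%N -> S != 0.
Proof.
move=> hn; have [j jN] := other_index hn; apply/eqP => S0.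
by have /eqP := meval_sumsq' j jN; rewrite S0 meval0 eq_sym oner_eq0.
Qed.

Lemma sumsqE : sumsq C n = S + x ^+ 2.
Proof. by rewrite /sumsq (bigD1 N) //= addrC. Qed.

Lemma mderiv_sumsq' : mderiv N S = 0.
Proof.
rewrite /sumsq' raddf_sum big1 //= => i iN.
by rewrite mderivXn mderivXU eq_sym (negPf iN) mul0r scaler0.
Qed.

(** A free upper bound lets sums for neighbouring degrees run over a common range. *)
Lemma FvecE (l M : nat) : (l./2 < M)%N ->
  F l%:Z = \sum_(k < M) fcoef C alpha l k *: (S ^+ k * x ^+ (l - k.*2)).
Proof.
move=> lM; rewrite /Fvec (big_ord_widen_cond M xpredT
  (fun k => Fcoef alpha l k *: (S ^+ k * x ^+ (l - k.*2)))) //=.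
rewrite big_mkcond /=; apply: eq_bigr => k _; rewrite /fcoef.
by rewrite ltnS geq_half_double; case: ifP; rewrite ?scale0r.
Qed.

(** The operator [xi_n * mderiv N] is diagonal on the products of powers of [sumsq'] and [xi_n], and
    avoids the exponent [l - 2 k - 1]. *)
Lemma euler_Fvec (l M : nat) : (l./2 < M)%N ->
  x * mderiv N (F l%:Z) =
  \sum_(k < M) ((l - k.*2)%:R * fcoef C alpha l k) *: (S ^+ k * x ^+ (l - k.*2)).
Proof.
move=> lM; rewrite (FvecE l M) // raddf_sum /= mulr_sumr.
apply: eq_bigr => k _; rewrite mderivZ mderivM !mderivXn mderiv_sumsq' mderivXU.
rewrite eqxx mul0r scaler0 mul0r add0r mul1r.
case: (l - k.*2)%N => [|m]; first by rewrite !(scale0r, mulr0, scaler0, mul0r).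
rewrite -!scalerAr scalerA [m.+1%:R * _]mulrC; congr (_ *: _).
by rewrite mulrCA -exprS.
Qed.

Lemma raise_poly (l : nat) :
  - (sumsq C n * mderiv N (F l%:Z)) - (l%:R + 2 * alpha) *: (x * F l%:Z) =
  c l *: F (l.+1)%:Z.
Proof.
have x0 : x != 0 by exact: mpolyXU_neq0.
(* The extra factor [xi_n] makes [euler_Fvec] applicable. *)
apply: (mulfI x0).
set M := l.+1.
transitivity (- ((S + x ^+ 2) * (x * mderiv N (F l%:Z)))
              - (l%:R + 2 * alpha) *: (x ^+ 2 * F l%:Z)).
  by rewrite sumsqE -!mul_mpolyC; ring.
rewrite (euler_Fvec l M) ?(FvecE l M) ?(FvecE l.+1 M.+1) /M; [|lia..].
pose u k := S ^+ k * x ^+ (l.+2 - k.*2).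
have -> : x * (c l *: \sum_(k < l.+2) fcoef C alpha l.+1 k *:
                 (S ^+ k * x ^+ (l.+1 - k.*2))) =
   \sum_(k < l.+2) (c l * fcoef C alpha l.+1 k) *: u k.
  rewrite -scalerAr mulr_sumr scaler_sumr; apply: eq_bigr => k _.
  rewrite -scalerAr scalerA /u; have [kl | kl] := leqP k.*2 l.+1.
    by rewrite mulrCA -exprS -subSn.
  by rewrite fcoef_gt // mulr0 !scale0r.
rewrite mulrDl !mulr_sumr opprD scaler_sumr -addrA -opprD -big_split /=.
have -> : \sum_(k < l.+1) (x ^+ 2 * ((l - k.*2)%:R * fcoef C alpha l k *:
              (S ^+ k * x ^+ (l - k.*2))) +
            (l%:R + 2 * alpha) *: (x ^+ 2 * (fcoef C alpha l k *:
              (S ^+ k * x ^+ (l - k.*2))))) =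
   \sum_(k < l.+2) ((l%:R - k%:R + alpha) * 2 * fcoef C alpha l k) *: u k.
  (* The added index [l.+1] has coefficient zero, since [2 (l + 1) > l]. *)
  rewrite [RHS]big_ord_recr /= [fcoef _ _ _ l.+1]fcoef_gt; last by lia.
  rewrite mulr0 scale0r addr0; apply: eq_bigr => k _.
  have [kl | kl] := leqP k.*2 l; last first.
    by rewrite fcoef_gt // !(mulr0, scale0r, scaler0, addr0).
  rewrite /u -!scalerAr scalerA -scalerDl mulrCA -exprD.
  rewrite natrB // -muln2 natrM (_ : 2 + (l - k * 2) = l.+2 - k * 2)%N; last by lia.
  by congr (_ *: _); ring.
have -> : \sum_(k < l.+1) S * ((l - k.*2)%:R * fcoef C alpha l k *:
              (S ^+ k * x ^+ (l - k.*2))) =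
   \sum_(k < l.+1) ((l - k.*2)%:R * fcoef C alpha l k) *: u k.+1.
  apply: eq_bigr => k _.
  by rewrite -scalerAr mulrA -exprS /u doubleS !subSS.
rewrite -!sumrN !(big_ord_recl l.+1) /= addrCA -big_split /= subr0.
congr (_ + _); first by rewrite -scaleNr fcoef_raise0.
apply: eq_bigr => k _; rewrite /bump /= add1n -fcoef_raise.
by rewrite scalerBl scaleNr.
Qed.

(** The identity [f F_(l+1) = d_(l+1) F_l] cleared of its denominators [xi_n] and [sumsq']. *)
Lemma lower_poly (l : nat) :
  sumsq C n * (x * mderiv N (F l.+1%:Z) - l.+1%:R *: F l.+1%:Z)
  + l.+1%:R *: (S * F l.+1%:Z) =
  S * (x * (d l.+1 *: F l%:Z)).
Proof.
transitivity ((S + x ^+ 2) * (x * mderiv N (F l.+1%:Z) - l.+1%:R *: F l.+1%:Z)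
  + l.+1%:R *: (S * F l.+1%:Z)); first by rewrite sumsqE.
set M := l.+2.
rewrite (euler_Fvec l.+1 M) ?(FvecE l.+1 M) ?(FvecE l M) /M; [|lia..].
pose u k := S ^+ k.+1 * x ^+ (l.+1 - k.*2).
have -> : S * (x * (d l.+1 *: \sum_(k < l.+2) fcoef C alpha l k *:
                 (S ^+ k * x ^+ (l - k.*2)))) =
   \sum_(k < l.+2) (d l.+1 * fcoef C alpha l k) *: u k.
  rewrite -!scalerAr !mulr_sumr scaler_sumr; apply: eq_bigr => k _.
  rewrite -!scalerAr scalerA /u; have [kl | kl] := leqP k.*2 l.
    by rewrite subSn // !exprS; congr (_ *: _); ring.
  by rewrite fcoef_gt // mulr0 !scale0r.
pose v k := S ^+ k * x ^+ (l.+1 - k.*2).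

(* Subtracting the degree from the Euler eigenvalue [l + 1 - 2 k] leaves [- 2 k]. *)
have -> : \sum_(k < l.+2) ((l.+1 - k.*2)%:R * fcoef C alpha l.+1 k) *: v k
  - l.+1%:R *: \sum_(k < l.+2) fcoef C alpha l.+1 k *: v k
  = - \sum_(k < l.+2) (k.*2%:R * fcoef C alpha l.+1 k) *: v k.
  rewrite scaler_sumr -!sumrN -big_split; apply: eq_bigr => k _ /=.
  rewrite scalerA -!scaleNr -scalerDl; congr (_ *: _).
  have [kl | kl] := leqP k.*2 l.+1; last by rewrite fcoef_gt // !mulr0 !(oppr0, addr0).
  by rewrite natrB //; ring.
rewrite mulrN mulrDl opprD addrAC !mulr_sumr scaler_sumr -sumrN -big_split /=.
(* The factor [2 k] removes the term at 0, which permits the shift from [k] to [k.+1]; the last term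
   on the right is zero. *)
have -> : \sum_(k < l.+2) x ^+ 2 * ((k.*2%:R * fcoef C alpha l.+1 k) *: v k) =
   \sum_(k < l.+2) (k.+1.*2%:R * fcoef C alpha l.+1 k.+1) *: u k.
  rewrite big_ord_recl [RHS]big_ord_recr /= [fcoef _ _ _ l.+2]fcoef_gt; last by lia.
  rewrite double0 mul0r !mulr0 !scale0r mulr0 add0r addr0; apply: eq_bigr => k _.
  rewrite /bump /= add1n; have [kl | kl] := leqP k.+1.*2 l.+1; last first.
    by rewrite fcoef_gt // !mulr0 !scale0r mulr0.
  rewrite /u /v -scalerAr mulrCA -exprD.
  by rewrite (_ : 2 + (l.+1 - k.+1.*2) = l.+1 - k.*2)%N; last by lia.
rewrite -sumrB; apply: eq_bigr => k _; rewrite -fcoef_lower.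
rewrite -!scalerAr [S * v k](_ : _ = u k); last by rewrite /u /v exprS mulrA.
rewrite scalerA -!scaleNr -!scalerDl; congr (_ *: _).
have [kl | kl] := leqP k.*2 l.+1; first by rewrite natrB //; ring.
by rewrite fcoef_gt // !mulr0 oppr0 addr0.
Qed.
End SingularVectors.

(** * Nonvanishing of the singular vectors and the action of the operators on them *)

Section Operators.
Variables (C : numFieldType) (n : nat) (N : 'I_n) (alpha : C).
Local Notation S := (sumsq' C N).
Local Notation x := ('X_N : {mpoly C[n]}).
Local Notation F := (Fvec N alpha).
Local Notation c := (raise_cst C alpha).
Local Notation d := (lower_cst C alpha).

Lemma Fvec_homog (l : nat) : F l%:Z \is l.-homog.
Proof.
apply: rpred_sum => k _; apply: rpredZ.
have [kl | kl] := leqP k.*2 l; last by have := ltn_ord k; lia.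
have SH : S \is 2.-homog.
  apply: rpred_sum => i _; apply: (@dhomogMn _ _ _ 1 _ 2).
  by rewrite dhomogX /= mdeg1.
have xH : x \is 1.-homog by rewrite dhomogX /= mdeg1.
have := dhomogM (dhomogMn k SH) (dhomogMn (l - k.*2) xH).
by rewrite mul2n mul1n subnKC.
Qed.

Hypothesis hn : (2 <= n)%N.

(** The coefficient of [sumsq' ^ m] carries an empty Pochhammer symbol, so it is a nonzero number
    independent of [alpha]. *)
Lemma Fvec_even_neq0 (m : nat) : F (m.*2)%:Z != 0.
Proof.
have [j jN] := other_index n N hn; apply/eqP => F0.
have : (F (m.*2)%:Z).@[other_point C n j] = fcoef C alpha m.*2 m.
  rewrite (FvecE _ _ _ _ _ m.+1) ?doubleK // raddf_sum big_ord_recr /= big1.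
    rewrite add0r mevalZ mevalM !rmorphXn /= meval_sumsq' // subnn expr0 expr1n.
    by rewrite !mulr1.
  move=> k _; rewrite mevalZ mevalM !rmorphXn /= mevalXU /other_point.
  rewrite eq_sym (negPf jN) expr0n (_ : _ == 0%N = false) ?mulr0 //.
  by have := ltn_ord k; lia.
rewrite F0 meval0; have := fcoef_even C alpha m 0; rewrite addn0 => ->.
rewrite poch0 mulr1 expr0 mulr1 => /esym/eqP.
by rewrite !mulf_eq0 !invr_eq0 !mulf_eq0 (negPf (fact_neq0 _ _)) (negPf (pow2_neq0 _ _))
  (negPf (fact_neq0 _ m)) /= fact0 oner_eq0.
Qed.

(* In odd degree the lowering operator acts by a nonzero constant, for every
   [alpha], so that nonvanishing is inherited from the even degree below. *)
Lemma Fvec_neq0 (l : nat) : F l%:Z != 0.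
Proof.
have [m [-> | ->]] := double_or_doubleS l; first exact: Fvec_even_neq0.
apply/eqP => F0; have /esym/eqP := lower_poly C n N alpha m.*2.
rewrite F0 raddf0 !mulr0 !scaler0 subr0 !mulr0 addr0 !mulf_eq0 scaler_eq0.
rewrite (negPf (sumsq'_neq0 _ _ _ hn)) (negPf (mpolyXU_neq0 _ _ _)).
rewrite (negPf (Fvec_even_neq0 _)) /lower_cst /= odd_double /= orbF.
by rewrite pnatr_eq0.
Qed.

Lemma e_xi_Fvec (l : nat) (a : C) :
  e_xi N alpha l%:Z (a *: F l%:Z)%:F = ((a * c l) *: F l.+1%:Z)%:F.
Proof.
rewrite -scalerA -raise_poly /e_xi pder_tofrac -mulrA /xi -[x%:F * _]tofracM cst_mul.
rewrite -tofracM -tofracN -tofracB mderivZ -!scalerAr scalerBr scalerN.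
by rewrite !scalerA [a * _]mulrC.
Qed.

Lemma mul_divDl (K : fieldType) (s q u v : K) :
  s != 0 -> s * (q / s * u + v) = q * u + s * v.
Proof. by move=> s0; rewrite mulrDr mulrA mulrCA divff // mulr1. Qed.

Lemma f_xi_Fvec (l : nat) (a : C) :
  f_xi N l%:Z (a *: F l%:Z)%:F = ((a * d l) *: F (l%:Z - 1))%:F.
Proof.
case: l => [|l].
  (* In degree 0 the target is [F_(-1) = 0], and the constant [F_0] is killed by the derivative. *)
  have -> : F 0%N = 1.
    rewrite (FvecE _ _ _ _ _ 1) // big_ord1 expr0 mul1r.
    have := fcoef_even C alpha 0 0; rewrite addn0 => ->.
    by rewrite poch0 !expr0 /= fact0 !(mulr1, invr1, expr0) scale1r.
  rewrite /f_xi pder_tofrac mderivZ -mpolyC1 mderivC scaler0.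
  rewrite /cst mpolyC0 tofrac0 !(mul0r, mulr0, subr0, addr0).
  by rewrite /= scaler0 tofrac0.
have S0 : (S%:F : ratfun C n) != 0 by rewrite tofrac_eq0 sumsq'_neq0.
have x0 := xi_neq0 C n N.
have -> : l.+1%:Z - 1 = l%:Z by lia.
apply: (mulfI x0); apply: (mulfI S0).
rewrite /f_xi pder_tofrac !cst_mul mulVKf //.
rewrite (mul_divDl _ _ _ _ _ S0) /xi -!tofracM -tofracB -!tofracM -tofracD.
congr (_%:F); rewrite mderivZ.
transitivity (a *: (S * (x * (d l.+1 *: F l%:Z)))).
  by rewrite -lower_poly -!mul_mpolyC; ring.
by rewrite -!mul_mpolyC mpolyCM; ring.
Qed.

Lemma h_xi_tofrac (l : nat) (p : {mpoly C[n]}) :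
  h_xi alpha l%:Z p%:F = ((2 * (l%:R + alpha)) *: p)%:F.
Proof. by rewrite /h_xi cst_mul. Qed.

(** With [mu = - 2 alpha] this is [(l + 1) (mu - l)], the classical constant on a module of highest
    weight [mu]; the dependence on parity cancels. *)
Lemma raise_lower (l : nat) : d l.+1 * c l = - l.+1%:R * (l%:R + 2 * alpha).
Proof.
by rewrite /raise_cst /lower_cst /=; case: (odd l) => /=; rewrite -natr1; ring.
Qed.

Lemma lower0 : d 0 = 0.
Proof. by rewrite /lower_cst mul0r. Qed.

End Operators.

(** * Linear maps on polynomials prescribed on monomials *)

Section MonomialBasis.
Variables (C : fieldType) (W : lmodType C) (w : nat -> W).

Definition lin_ext (p : {poly C}) : W := \sum_(l < size p) p`_l *: w l.

Lemma lin_ext_widen (m : nat) (p : {poly C}) : (size p <= m)%N ->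
  lin_ext p = \sum_(l < m) p`_l *: w l.
Proof.
move=> pm; rewrite /lin_ext (big_ord_widen m (fun l => p`_l *: w l)) //.
rewrite big_mkcond; apply: eq_bigr => l _; case: ifPn => //.
by rewrite -leqNgt => /(nth_default 0) ->; rewrite scale0r.
Qed.

Lemma lin_ext_is_linear : linear lin_ext.
Proof.
move=> a p q; set m := maxn (size p) (size q).
rewrite (lin_ext_widen m p) ?(lin_ext_widen m q) ?leq_maxl ?leq_maxr //.
rewrite (lin_ext_widen m) => [|].
  rewrite scaler_sumr -big_split; apply: eq_bigr => l _ /=.
  by rewrite coefD coefZ scalerDl scalerA.
rewrite (leq_trans (size_polyD _ _)) // geq_max leq_maxr andbT.
by rewrite (leq_trans (size_scale_leq _ _)) // leq_maxl.
Qed.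

HB.instance Definition _ :=
  GRing.isLinear.Build C {poly C} W _ lin_ext lin_ext_is_linear.

Lemma lin_extXn (l : nat) : lin_ext 'X^l = w l.
Proof.
rewrite /lin_ext size_polyXn big_ord_recr /= coefXn eqxx scale1r big1 ?add0r //.
by move=> k _; rewrite coefXn ltn_eqF ?scale0r.
Qed.

Lemma poly_lin_eq (f g : {linear {poly C} -> W}) :
  (forall l, f 'X^l = g 'X^l) -> f =1 g.
Proof.
move=> fg p; rewrite -[p]coefK poly_def !linear_sum.
by apply: eq_bigr => l _; rewrite !linearZ fg.
Qed.

End MonomialBasis.

(** * The abstract ladder module and the Verma criterion *)

Section LadderModule.
Variables (C : numFieldType) (alpha : C).

Local Notation c := (raise_cst C alpha).
Local Notation d := (lower_cst C alpha).
Local Notation mu := (- 2 * alpha).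

Definition raise_op : {linear {poly C} -> {poly C}} :=
  lin_ext C _ (fun l => c l *: 'X^(l.+1)).
(** The truncated predecessor at [l = 0] is harmless because [d 0 = 0]. *)
Definition lower_op : {linear {poly C} -> {poly C}} :=
  lin_ext C _ (fun l => d l *: 'X^(l.-1)).
Definition weight_op : {linear {poly C} -> {poly C}} :=
  lin_ext C _ (fun l => (2 * (l%:R + alpha)) *: 'X^l).

#[local] Arguments raise_op : simpl never.
#[local] Arguments lower_op : simpl never.
#[local] Arguments weight_op : simpl never.

Lemma raise_opXn l : raise_op 'X^l = c l *: 'X^(l.+1).
Proof. exact: lin_extXn. Qed.

Lemma lower_opXn l : lower_op 'X^l = d l *: 'X^(l.-1).
Proof. exact: lin_extXn. Qed.

Lemma weight_opXn l : weight_op 'X^l = (2 * (l%:R + alpha)) *: 'X^l.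
Proof. exact: lin_extXn. Qed.

Lemma coef_weight_op p k : (weight_op p)`_k = 2 * (k%:R + alpha) * p`_k.
Proof.
have -> : weight_op p = \poly_(l < size p) (2 * (l%:R + alpha) * p`_l).
  rewrite poly_def; apply: eq_bigr => l _ /=.
  by rewrite scalerA mulrC.
rewrite coef_poly; case: ltnP => // /(nth_default 0) ->.
by rewrite mulr0.
Qed.

Lemma ladder_sl2 : sl2_module raise_op lower_op weight_op.
Proof.
split=> v.
- apply: (poly_lin_eq C _ ((raise_op \o lower_op) \- (lower_op \o raise_op))).
  move=> l /=; rewrite lower_opXn raise_opXn !linearZ /= lower_opXn.
  rewrite weight_opXn scalerN scalerA [c l * _]mulrC raise_lower.
  case: l => [|l].
    by rewrite lower0 scale0r sub0r -scaleNr; congr (_ *: _); ring.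
  rewrite raise_opXn scalerA raise_lower -scalerBl; congr (_ *: _).
  by rewrite -[l.+2%:R]natr1 -[l.+1%:R]natr1; ring.
- apply: (poly_lin_eq C _ ((weight_op \o raise_op) \- (raise_op \o weight_op))
    (2 \*: raise_op)).
  move=> l /=; rewrite weight_opXn raise_opXn !linearZ /= weight_opXn raise_opXn.
  by rewrite scalerN !scalerA -scalerBl; congr (_ *: _); rewrite -natr1; ring.
- apply: (poly_lin_eq C _ ((weight_op \o lower_op) \- (lower_op \o weight_op))
    ((- 2) \*: lower_op)).
  move=> l /=; rewrite weight_opXn lower_opXn !linearZ /= weight_opXn lower_opXn.
  rewrite scalerN !scalerA -scalerBl; congr (_ *: _).
  by case: l => [|l] /=; [rewrite lower0; ring | rewrite -natr1; ring].
Qed.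

(** In odd degree the constant is [-1]; in degree [2 k] it is [- 2 (alpha + k)]. *)
Lemma raise_cst_neq0 : (forall l, c l != 0) <-> (forall k : nat, alpha != - k%:R).
Proof.
have cE k : c k.*2 = - (2 * (alpha + k%:R)).
  by rewrite /raise_cst odd_double -muln2 natrM; ring.
split=> [c0 k | a0 l].
  apply: contraNneq (c0 k.*2) => aE.
  by rewrite cE aE addNr mulr0 oppr0.
have [k [-> | ->]] := double_or_doubleS l; last first.
  by rewrite /raise_cst /= odd_double oppr_eq0 oner_eq0.
by rewrite cE oppr_eq0 mulf_neq0 ?pnatr_eq0 // addr_eq0.
Qed.

Lemma iter_raise_op m : iter m raise_op 1 = (\prod_(l < m) c l) *: 'X^m.
Proof.
elim: m => [|m IH]; first by rewrite big_ord0 scale1r expr0.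
by rewrite iterS IH linearZ /= raise_opXn scalerA big_ord_recr.
Qed.

Section HighestWeight.
Variables (W : lmodType C) (X Y H : {linear W -> W}) (w0 : W) (nu : C).
Hypotheses (sl2W : sl2_module X Y H) (Xw0 : X w0 = 0) (Hw0 : H w0 = nu *: w0).

Lemma weight_iter m : H (iter m Y w0) = (nu - 2 * m%:R) *: iter m Y w0.
Proof.
have [_ _ HY] := sl2W; elim: m => [|m IH]; first by rewrite mulr0 subr0.
rewrite iterS; move: (HY (iter m Y w0)); rewrite IH linearZ /= => /eqP.
rewrite subr_eq => /eqP ->; rewrite -scalerDl; congr (_ *: _).
by rewrite -natr1; ring.
Qed.

(** The classical induction: [X] commutes past one [Y] at the cost of [H], whose eigenvalues
    [weight_iter] supplies. *)
Lemma raise_iter m :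
  X (iter m.+1 Y w0) = (m.+1%:R * (nu - m%:R)) *: iter m Y w0.
Proof.
have [XY _ _] := sl2W; elim: m => [|m IH].
  by have := XY w0; rewrite Xw0 linear0 subr0 Hw0 /= => ->; congr (_ *: _); ring.
rewrite iterS; move: (XY (iter m.+1 Y w0)); rewrite IH linearZ weight_iter => /eqP.
rewrite subr_eq => /eqP ->; rewrite -iterS -scalerDl; congr (_ *: _).
by rewrite -[m.+2%:R]natr1 -[m.+1%:R]natr1; ring.
Qed.

End HighestWeight.

(* The Verma module of highest weight [nu], realized by differential operators:
   [Y ^ l] applied to the highest weight vector is ['X^l]. *)
Definition verma_X (nu : C) (p : {poly C}) : {poly C} := nu *: p^`() - 'X * p^`()^`().
Definition verma_Y (p : {poly C}) : {poly C} := 'X * p.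
Definition verma_H (nu : C) (p : {poly C}) : {poly C} := nu *: p - 2 *: ('X * p^`()).

Lemma verma_X_linear nu : linear (verma_X nu).
Proof.
by move=> a p q; rewrite /verma_X !(derivD, derivZ) -!mul_polyC; ring.
Qed.
Lemma verma_Y_linear : linear verma_Y.
Proof. by move=> a p q; rewrite /verma_Y -!mul_polyC; ring. Qed.
Lemma verma_H_linear nu : linear (verma_H nu).
Proof.
by move=> a p q; rewrite /verma_H !(derivD, derivZ) -!mul_polyC; ring.
Qed.

HB.instance Definition _ nu :=
  GRing.isLinear.Build C {poly C} {poly C} _ (verma_X nu) (verma_X_linear nu).
HB.instance Definition _ :=
  GRing.isLinear.Build C {poly C} {poly C} _ verma_Y verma_Y_linear.
HB.instance Definition _ nu :=
  GRing.isLinear.Build C {poly C} {poly C} _ (verma_H nu) (verma_H_linear nu).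

Lemma verma_sl2 nu : sl2_module (verma_X nu) verma_Y (verma_H nu).
Proof.
by split=> p; rewrite /= /verma_X /verma_Y /verma_H
  !(derivB, derivD, derivM, derivX, derivZ, derivC) -!mul_polyC; ring.
Qed.

(** If no [c_l] vanishes, the iterates of [raise_op] on 1 are nonzero multiples of the monomials,
    which forces and defines the morphism. If [c_l = 0], the iterate [l.+1] is zero, whereas a
    morphism to a genuine Verma module would give it a nonzero image. *)
Lemma ladder_verma :
  verma_module lower_op raise_op (\- weight_op) mu 1 <->
  forall l, c l != 0.
Proof.
have X0 : lower_op 1 = 0 by rewrite -(expr0 'X) lower_opXn lower0 scale0r.
have H0 : (\- weight_op) 1 = mu *: 1.
  rewrite -(expr0 'X) /= weight_opXn -scaleNr; congr (_ *: _); ring.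
have [EF HE HF] := ladder_sl2.
split.
  case=> _ _ _ univ l; apply/eqP => cl0.
  (* The test module is the differential-operator model, where no power of [Y] kills the highest
     weight vector. *)
  have vX0 : verma_X mu 1 = 0 by rewrite /verma_X -polyC1 derivC deriv0 scaler0 mulr0 subr0.
  have vH0 : verma_H mu 1 = mu *: 1 by rewrite /verma_H -polyC1 derivC mulr0 scaler0 subr0.
  have [phi [[_ phiY _ phi1] _]] := univ _ _ _ _ 1 (verma_sl2 mu) vX0 vH0.
  have phi_iter m : phi (iter m raise_op 1) = 'X^m.
    by elim: m => [|m IH]; rewrite ?expr0 // iterS phiY IH exprS.
  have := phi_iter l.+1; rewrite iter_raise_op big_ord_recr /= cl0 mulr0 scale0r linear0.
  by move/eqP; rewrite eq_sym expf_eq0 polyX_eq0.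
move=> c0; split=> //.
  split=> v /=.
  - by rewrite -EF opprB.
  - by rewrite linearN opprK addrC -opprB HF scaleNr opprK.
  - by rewrite linearN opprK addrC -opprB HE scaleNr.
move=> W X Y H w0 sl2W Xw0 Hw0 hom.
(* Since [iter m raise_op 1] is [P m *: 'X^m], a morphism must send ['X^m] to
   [(P m)^-1 *: iter m Y w0]. *)
pose P m := \prod_(l < m) c l.
have PS m : P m.+1 = P m * c m by rewrite /P big_ord_recr.
have P0 m : P m != 0 by apply/prodf_neq0 => l _.
have [phi phiXn] : exists phi : {linear {poly C} -> W},
    forall m, phi 'X^m = (P m)^-1 *: iter m Y w0.
  by exists (lin_ext C W (fun m => (P m)^-1 *: iter m Y w0)) => m; exact: lin_extXn.
exists phi; split.
  split.
  - apply: (poly_lin_eq C _ (phi \o lower_op) (X \o phi)) => l /=.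
    rewrite lower_opXn linearZ_LR !phiXn [X _]linearZ_LR.
    case: l => [|l]; first by rewrite lower0 scale0r Xw0 scaler0.
    rewrite (raise_iter W X Y H w0 mu) // !scalerA; congr (_ *: _).
    (* Trading [d l.+1] for [c l] produces the constant of [raise_iter]. *)
    rewrite PS; have -> : d l.+1 = - l.+1%:R * (l%:R + 2 * alpha) / c l.
      by rewrite -raise_lower mulfK.
    by field; rewrite P0 c0.
  - apply: (poly_lin_eq C _ (phi \o raise_op) (Y \o phi)) => l /=.
    rewrite raise_opXn linearZ_LR !phiXn [Y _]linearZ_LR scalerA PS invfM.
    by rewrite mulrCA mulfV // mulr1.
  - apply: (poly_lin_eq C _ (phi \o \- weight_op) (H \o phi)) => l /=.
    rewrite weight_opXn linearN linearZ_LR !phiXn [H _]linearZ_LR.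
    rewrite (weight_iter W X Y H w0 mu) // !scalerA -scaleNr.
    by congr (_ *: _); ring.
  - by rewrite -(expr0 'X) phiXn /P big_ord0 invr1 scale1r.
move=> psi [_ psiY _ psi1]; apply: poly_lin_eq => m.
have XE : 'X^m = (P m)^-1 *: iter m raise_op 1.
  by rewrite iter_raise_op scalerA mulVf // scale1r.
rewrite phiXn XE linearZ_LR {XE}; congr (_ *: _).
by elim: m => [|m IH] //; rewrite !iterS psiY IH.
Qed.

End LadderModule.

(** * Embedding the ladder module into the polynomial ring *)

Section Realization.
Variables (C : numFieldType) (n : nat) (N : 'I_n) (alpha : C).
Hypothesis hn : (2 <= n)%N.

Local Notation F := (Fvec N alpha).

#[local] Arguments Fvec : simpl never.

Definition ladder_iota : {linear {poly C} -> {mpoly C[n]}} :=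
  lin_ext C _ (fun l => F l%:Z).

#[local] Arguments ladder_iota : simpl never.

Lemma ladder_iotaXn (l : nat) : ladder_iota 'X^l = F l%:Z.
Proof. exact: lin_extXn. Qed.

Lemma ladder_iotaZXn (a : C) (l : nat) : ladder_iota (a *: 'X^l) = a *: F l%:Z.
Proof. by rewrite linearZ_LR ladder_iotaXn. Qed.

(** By homogeneity only the summand of degree [mdeg m] contains the monomial [m]. *)
Lemma mcoeff_ladder_iota (p : {poly C}) (m : 'X_{1..n}) :
  (ladder_iota p)@_m = p`_(mdeg m) * (F (mdeg m)%:Z)@_m.
Proof.
rewrite -[ladder_iota p]/(lin_ext C _ (fun l => F l%:Z) p).
rewrite (lin_ext_widen _ _ _ (maxn (size p) (mdeg m).+1)) ?leq_maxl //.
have m_lt : (mdeg m < maxn (size p) (mdeg m).+1)%N by rewrite leq_maxr.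
rewrite raddf_sum (bigD1 (Ordinal m_lt)) //= mcoeffZ big1 ?addr0 // => l lm.
rewrite mcoeffZ (dhomog_nemf_coeff (Fvec_homog C n N alpha l)) ?mulr0 //.
by rewrite eq_sym -val_eqE in lm.
Qed.

Lemma ladder_iota_inj : injective ladder_iota.
Proof.
move=> p q pq; apply/polyP => l.
(* The leading monomial of [F_l] serves as [m]; its coefficient in the image recovers that of
   ['X^l]. *)
have [m Fm] : exists m, (F l%:Z)@_m != 0.
  have := Fvec_neq0 C n N alpha hn l; rewrite -mleadc_eq0 => ?.
  by eexists; eassumption.
have ml : mdeg m = l.
  by apply/eqP; apply: contraNT Fm => ml; rewrite (dhomog_nemf_coeff (Fvec_homog C n N alpha l)).
have := congr1 (mcoeff m) pq; rewrite !mcoeff_ladder_iota ml.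
exact: mulIf.
Qed.

Lemma line_ladder_iota (l : nat) (p : {poly C}) :
  line (F l%:Z) (ladder_iota p)%:F <-> exists a, p = a *: 'X^l.
Proof.
split=> [[a /eqP] | [a ->]]; last by exists a; rewrite ladder_iotaZXn.
rewrite tofrac_eq -ladder_iotaZXn => /eqP /ladder_iota_inj ->.
by exists a.
Qed.

Lemma ladder_realizes :
  realizes N alpha (raise_op C alpha) (lower_op C alpha) (weight_op C alpha)
    ladder_iota.
Proof.
split; first exact: ladder_iota_inj.
  move=> p; split=> [[v <-] | [m [a ->]]].
    by exists (size v), (fun l => v`_l).
  exists (\poly_(l < m) a l); rewrite poly_def linear_sum.
  by apply: eq_bigr => l _; rewrite ladder_iotaZXn.
move=> l v /line_ladder_iota [a ->].
rewrite ladder_iotaZXn; split.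
- rewrite e_xi_Fvec (linearZ_LR (raise_op C alpha)) raise_opXn scalerA.
  by rewrite ladder_iotaZXn.
- rewrite f_xi_Fvec // (linearZ_LR (lower_op C alpha)) lower_opXn scalerA.
  rewrite ladder_iotaZXn; case: l => [|l].
    by rewrite lower0 mulr0 !scale0r.
  by rewrite (_ : l.+1%:Z - 1 = l%:Z) //; lia.
- rewrite h_xi_tofrac (linearZ_LR (weight_op C alpha)) weight_opXn scalerA.
  by rewrite scalerA ladder_iotaZXn mulrC.
Qed.

(** The eigenvalues in degrees [k] and [l] differ by [2 (l - k)], nonzero for [k != l] in
    characteristic 0, so an eigenvector has a single coefficient. *)
Lemma ladder_weight_space (l : nat) (p : {poly C}) :
  (\- weight_op C alpha) p = (- 2 * alpha - 2 * l%:R) *: p <->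
  line (F l%:Z) (ladder_iota p)%:F.
Proof.
rewrite line_ladder_iota; split=> [Hp | [a ->]].
  exists p`_l; apply/polyP => k; rewrite coefZ coefXn.
  have [-> | kl] := eqVneq k l; first by rewrite mulr1.
  have /(congr1 (fun q : {poly C} => q`_k)) := Hp.
  rewrite /= coefN coef_weight_op coefZ => /eqP.
  rewrite -subr_eq0 -mulNr -mulrBl mulf_eq0 mulr0 => /orP[|/eqP //].
  have -> : - (2 * (k%:R + alpha)) - (- 2 * alpha - 2 * l%:R) = 2 * (l%:R - k%:R) :> C.
    by ring.
  by rewrite mulf_eq0 pnatr_eq0 subr_eq0 eqr_nat [_ == k]eq_sym (negPf kl).
rewrite /= linearZ_LR weight_opXn -scalerN -scaleNr !scalerA; congr (_ *: _).
by ring.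
Qed.

Lemma line_preserved (l : nat) (v : ratfun C n) : line (F l%:Z) v ->
  [/\ line (F (l%:Z + 1)) (e_xi N alpha l%:Z v),
      line (F (l%:Z - 1)) (f_xi N l%:Z v)
    & line (F l%:Z) (h_xi alpha l%:Z v)].
Proof.
case=> a ->; rewrite e_xi_Fvec f_xi_Fvec // h_xi_tofrac scalerA.
split; [|by eexists..].
by exists (a * raise_cst C alpha l); rewrite -PoszD addn1.
Qed.

Lemma commutation (l : nat) (v : ratfun C n) : line (F l%:Z) v ->
  [/\ e_xi N alpha (l%:Z - 1) (f_xi N l%:Z v) - f_xi N (l%:Z + 1) (e_xi N alpha l%:Z v)
        = h_xi alpha l%:Z v,
      h_xi alpha (l%:Z + 1) (e_xi N alpha l%:Z v) - e_xi N alpha l%:Z (h_xi alpha l%:Z v)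
        = 2 * e_xi N alpha l%:Z v
    & h_xi alpha (l%:Z - 1) (f_xi N l%:Z v) - f_xi N l%:Z (h_xi alpha l%:Z v)
        = - 2 * f_xi N l%:Z v].
Proof.
have two (q : {mpoly C[n]}) : 2 * q%:F = (2 *: q)%:F.
  by rewrite mulr_natl -tofracMn scaler_nat.
(* This serves degree 0, where [e] of index [-1] is applied to [f F_0 = 0]. *)
have e0 k : e_xi N alpha k (0 : ratfun C n) = 0.
  by rewrite /e_xi -tofrac0 pder_tofrac linear0 tofrac0 !mulr0 !oppr0 addr0.
case=> a ->; have -> : l%:Z + 1 = l.+1%:Z by lia.
rewrite h_xi_tofrac scalerA e_xi_Fvec !f_xi_Fvec // e_xi_Fvec h_xi_tofrac.
rewrite f_xi_Fvec // mulNr !two.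
have -> : l.+1%:Z - 1 = l%:Z by lia.
split.
- case: l => [|l].
    rewrite lower0 mulr0 scale0r tofrac0 e0 sub0r -tofracN -scaleNr.
    congr (_%:F); congr (_ *: _); rewrite -mulrA [_ * lower_cst _ _ _]mulrC raise_lower.
    ring.
  rewrite (_ : l.+1%:Z - 1 = l%:Z); last by lia.
  rewrite e_xi_Fvec -tofracB -scalerBl; congr (_%:F); congr (_ *: _).
  rewrite -!mulrA raise_lower [_ * lower_cst _ _ _]mulrC raise_lower.
  by rewrite -[l.+2%:R]natr1 -[l.+1%:R]natr1; ring.
- rewrite -tofracB !scalerA -scalerBl; congr (_%:F); congr (_ *: _).
  by rewrite -natr1; ring.
- case: l => [|l].
    by rewrite lower0 !mulr0 !scale0r tofrac0 /h_xi mulr0 scaler0 tofrac0 subr0 oppr0.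
  rewrite (_ : l.+1%:Z - 1 = l%:Z); last by lia.
  rewrite h_xi_tofrac -tofracB -tofracN !scalerA -scalerBl -scaleNr.
  by congr (_%:F); congr (_ *: _); rewrite -natr1; ring.
Qed.

End Realization.

Theorem theorem2p4 (R : realType) (n : nat) (hn : (2 <= n)%N)
    (N : 'I_n) (hN : N.+1 = n :> nat) (lambda alpha : R[i])
    (halpha : alpha = - lambda - (n%:R - 1) / 2) :
  let Fl := Fvec N alpha in
  let e := e_xi N alpha in
  let f := @f_xi R[i] n N in
  let h := @h_xi R[i] n alpha in
  (* the operators map the lines <F_l> as indicated *)
  (forall (l : nat) (x : ratfun R[i] n), line (Fl l%:Z) x ->
     [/\ line (Fl (l%:Z + 1)) (e l%:Z x),
         line (Fl (l%:Z - 1)) (f l%:Z x)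
       & line (Fl l%:Z) (h l%:Z x)])
  (* commutation relations on each <F_l> *)
  /\ (forall (l : nat) (x : ratfun R[i] n), line (Fl l%:Z) x ->
     [/\ e (l%:Z - 1) (f l%:Z x) - f (l%:Z + 1) (e l%:Z x) = h l%:Z x,
         h (l%:Z + 1) (e l%:Z x) - e l%:Z (h l%:Z x) = 2 * e l%:Z x
       & h (l%:Z - 1) (f l%:Z x) - f l%:Z (h l%:Z x) = - 2 * f l%:Z x])
  (* the F_l span the one-dimensional weight spaces of the resulting module,
     a Verma module of highest weight -2 alpha for the triple (f, e, -h) *)
  /\ exists (V : lmodType R[i]) (E F H : {linear V -> V})
       (iota : {linear V -> {mpoly R[i][n]}}) (v0 : V),
     [/\ realizes N alpha E F H iota,
         sl2_module E F H,
         iota v0 = Fl 0,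
         forall l : nat, Fl l%:Z != 0 /\
           forall v : V,
             (\- H : {linear V -> V}) v = (- 2 * alpha - 2 * l%:R) *: v <->
             line (Fl l%:Z) (iota v)%:F
       & verma_module F E (\- H) (- 2 * alpha) v0 <->
         forall k : nat, alpha != - k%:R].
Proof.
move=> Fl e f h; split; first exact: line_preserved.
split; first exact: commutation.
(* The highest weight vector is [1 = 'X^0], which stands for [F_0]. *)
exists {poly R[i]}, (raise_op _ alpha), (lower_op _ alpha), (weight_op _ alpha),
  (ladder_iota _ n N alpha), 1.
split.
- exact: ladder_realizes.
- exact: ladder_sl2.
- by rewrite -(expr0 'X) ladder_iotaXn.
- by move=> l; split; [exact: Fvec_neq0 | exact: ladder_weight_space].
- exact: (iff_trans (ladder_verma _ _) (raise_cst_neq0 _ _)).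
Qed.
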